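(* Let two models be represented by the polynomial chaos expansions $$Q_H(\bm{\eta}_{H,r_H})=\sum_{\bm{\gamma}\in\mathcal{J}_{p_H}^{r_H}}c_{H,\bm{\gamma}}\,\psi_{\bm{\gamma}}(\bm{\eta}_{H,r_H}),\qquad Q_L(\bm{\eta}_{L,r_L})=\sum_{\bm{\gamma}\in\mathcal{J}_{p_L}^{r_L}}c_{L,\bm{\gamma}}\,\psi_{\bm{\gamma}}(\bm{\eta}_{L,r_L}),$$ with real coefficients, where $\bm{\eta}_{H,r_H}$ and $\bm{\eta}_{L,r_L}$ consist of the first $r_H$ and the first $r_L$ components of a common standard Gaussian vector $\bm{\eta}_s\in\mathbb{R}^{\max(r_H,r_L)}$, and each expansion has at least one nonzero coefficient with index different from $\bm{e}_0$. Then the (Pearson) correlation of the two models is $$\rho\big(Q_H(\bm{\eta}_{H,r_H}),Q_L(\bm{\eta}_{L,r_L})\big)=\frac{\displaystyle\sum_{\bm{\gamma}\in(\mathcal{J}_{p_H}^{r_H}\cap\mathcal{J}_{p_L}^{r_L})\setminus\{\bm{e}_0\}}c_{H,\bm{\gamma}}\,c_{L,\bm{\gamma}}}{\sqrt{\Big(\displaystyle\sum_{\bm{\gamma}\in\mathcal{J}_{p_H}^{r_H}\setminus\{\bm{e}_0\}}c_{H,\bm{\gamma}}^2\Big)\Big(\displaystyle\sum_{\bm{\gamma}\in\mathcal{J}_{p_L}^{r_L}\setminus\{\bm{e}_0\}}c_{L,\bm{\gamma}}^2\Big)}}.$$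
   Context: For integers $r\ge1$, $p\ge0$, $\mathcal{J}_p^r=\{\bm{\gamma}=(\gamma_1,\dots,\gamma_r)\in\mathbb{N}_0^r:\ \gamma_1+\dots+\gamma_r\le p\}$. For a multi-index $\bm{\gamma}$, $\psi_{\bm{\gamma}}(\bm{\eta})=\prod_i h_{\gamma_i}(\eta_i)$, where $h_n$ is the degree-$n$ Hermite polynomial normalized so that $\{h_n\}$ is orthonormal in $L^2$ of the standard Gaussian measure on $\mathbb{R}$ (so $h_0=1$). $\bm{e}_0$ is the all-zeros multi-index. Multi-indices of different lengths $r_H$, $r_L$ are compared (and intersections formed) after padding with zeros to length $\max(r_H,r_L)$; padding does not change the polynomial $\psi_{\bm{\gamma}}$. *)

(* Defs.v *)
From HB Require Import structures.
From mathcomp Require Import all_boot all_order all_algebra.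
From mathcomp Require Import all_classical all_reals all_analysis.

Set Implicit Arguments.
Unset Strict Implicit.
Unset Printing Implicit Defensive.

Import Order.TTheory GRing.Theory Num.Theory.

Local Open Scope classical_set_scope.
Local Open Scope ring_scope.

Definition multi_index (r : nat) := {ffun 'I_r -> nat}.

Definition e0 (r : nat) : multi_index r := [ffun=> 0%N].

Definition total_degree (r p : nat) : set (multi_index r) :=
  [set g : multi_index r | (\sum_(i < r) g i <= p)%N].

Arguments total_degree : clear implicits.

(* Sums over subsets of [total_degree r p] are written with the finitely
   supported sum [\sum_(g \in A) F g], which is 0 on infinite supports; this
   lemma shows that they are the ordinary finite sums. *)
Lemma finite_total_degree (r p : nat) : finite_set (total_degree r p).
Proof.
pose f (g : {ffun 'I_r -> 'I_p.+1}) : multi_index r := [ffun i => g i : nat].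
apply: (@sub_finite_set _ _ (f @` setT)); last first.
  by apply: finite_image; exact: finite_finset.
move=> g /= hg; exists [ffun i => inord (g i)] => //.
apply/ffunP => i; rewrite !ffunE inordK// ltnS.
by apply: leq_trans hg; rewrite (bigD1 i)//= leq_addr.
Qed.

Definition pad (r m : nat) (g : multi_index r) : multi_index m :=
  [ffun i : 'I_m => if insub (val i) is Some j then g j else 0%N].

Definition unpad (r m : nat) (le_rm : (r <= m)%N) (g : multi_index m) :
    multi_index r :=
  [ffun i => g (widen_ord le_rm i)].

(* On padded multi-indices [unpad] recovers the original one, so the coefficient
   attached to a padded index [g] is [c (unpad _ g)]. *)
Lemma padK (r m : nat) (le_rm : (r <= m)%N) :
  cancel (@pad r m) (unpad le_rm).
Proof.
move=> g; apply/ffunP => i; rewrite !ffunE /=.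
by rewrite (insubT (fun k => k < r)%N (ltn_ord i)) /=; congr (g _); apply: val_inj.
Qed.

(* Probabilists' Hermite polynomials: the recurrence is Rodrigues' formula
   He_n(x) = (-1)^n exp(x^2/2) (d/dx)^n exp(-x^2/2) with one derivative
   carried out. *)
Fixpoint hermite (R : realType) (n : nat) : {poly R} :=
  if n is k.+1 then 'X * hermite R k - (hermite R k)^`() else 1.

(* n! is the squared norm of He_n in L^2 of the standard Gaussian measure. *)
Definition hermite_normalized (R : realType) (n : nat) : {poly R} :=
  (Num.sqrt n`!%:R)^-1 *: hermite R n.

Definition psi (R : realType) (r : nat) (g : multi_index r) (x : 'I_r -> R) : R :=
  \prod_(i < r) (hermite_normalized R (g i)).[x i].

Definition chaos_expansion (R : realType) (r p : nat) (c : multi_index r -> R)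
    (x : 'I_r -> R) : R :=
  \sum_(g \in total_degree r p) c g * psi g x.

Definition mutually_independent d (T : measurableType d) (R : realType)
    (P : probability T R) (I : finType) (X : I -> {RV P >-> R}) : Prop :=
  forall (J : {set I}) (A : I -> set R), (forall i, measurable (A i)) ->
    P (\bigcap_(i in [set` J]) (X i @^-1` A i)) =
    (\prod_(i in J) P (X i @^-1` A i))%E.

Definition standard_gaussian_vector d (T : measurableType d) (R : realType)
    (P : probability T R) (s : nat) (eta : 'I_s -> {RV P >-> R}) : Prop :=
  (forall (i : 'I_s) (A : set R), measurable A ->
     distribution P (eta i) A = normal_prob 0 1 A) /\
  mutually_independent eta.

Definition correlation d (T : measurableType d) (R : realType)
    (P : probability T R) (X Y : T -> R) : R :=
  fine (covariance P X Y) /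
    (Num.sqrt (fine 'V_P[X]%E) * Num.sqrt (fine 'V_P[Y]%E)).

(* Main.v *)
Require Import Defs.
From HB Require Import structures.
From mathcomp Require Import all_boot all_order all_algebra.
From mathcomp Require Import all_classical all_reals all_analysis.
From mathcomp Require Import measurable_realfun.
From mathcomp Require Import ring.

(* The [psi_g] composed with a standard Gaussian vector are orthonormal: by
   independence the mean of [psi_g psi_h] is a product of one-dimensional
   means, and Stein's identity [E[X p(X)] = E[p'(X)]], applied [n] times, gives
   [E[He_n(X) q(X)] = E[q^(n)(X)]], hence [E[He_n(X) He_m(X)] = n! (n == m)].
   Since [psi_0 = 1], the covariance of two expansions is the inner product of
   their coefficients away from the zero index; padding brings both models to
   the same index set. *)

Set Implicit Arguments.
Unset Strict Implicit.
Unset Printing Implicit Defensive.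

Import Order.TTheory GRing.Theory Num.Theory.
Import numFieldNormedType.Exports.

Local Open Scope classical_set_scope.
Local Open Scope ring_scope.

(** * Change of variables for nonnegative functions against a measure with density *)

Section density_transfer.
Local Open Scope ereal_scope.
Import HBNNSimple.

(* Under [muXA], [nu] is the image under [X] of the measure with density [g]
   with respect to [mu]. *)
Lemma ge0_integral_transfer d d' (T : measurableType d) (U : measurableType d')
    (R : realType) (mu : {measure set T -> \bar R})
    (nu : {measure set U -> \bar R}) (X : T -> U) (g : T -> R) (f : U -> R) :
  measurable_fun setT X -> measurable_fun setT g -> (forall x, 0 <= g x)%R ->
  (forall A, measurable A -> \int[mu]_(x in X @^-1` A) (g x)%:E = nu A) ->
  measurable_fun setT f -> (forall y, 0 <= f y)%R ->
  \int[mu]_x (f (X x) * g x)%:E = \int[nu]_y (f y)%:E.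
Proof.
move=> mX mg g0 muXA mf f0.
have mfE : measurable_fun [set: U] (EFin \o f : U -> \bar R).
  exact/measurable_EFinP.
have f0E y : setT y -> 0 <= (EFin \o f) y by rewrite lee_fin.
have mindX A : measurable A -> measurable_fun setT (fun x => \1_A (X x) : R).
  by move=> mA; exact: (measurableT_comp (measurable_indic mA)).
pose f_ := nnsfun_approx measurableT mfE.
have mf_X n : measurable_fun setT (fun x => f_ n (X x)).
  by apply: (measurableT_comp (f := f_ n)).
have cvgf y : EFin \o f_ ^~ y @ \oo --> (f y)%:E.
  exact: (cvg_nnsfun_approx measurableT mfE f0E).
have ndf : nondecreasing_seq (f_ : (U -> R)^nat).
  exact: nd_nnsfun_approx.
(* Both sides are monotone limits along the simple functions [f_ n] increasing to [f]; since [g] is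
   nonnegative, [f_ n (X x) * g x] increases as well. *)
transitivity (limn (fun n => \int[nu]_y (f_ n y)%:E)); last first.
  rewrite -monotone_convergence//.
  - by apply: eq_integral => y _; apply/cvg_lim => //; exact: cvgf.
  - by move=> n; exact/measurable_EFinP/measurable_funP.
  - by move=> n y _; rewrite lee_fin.
  - by move=> y _ m n mn; rewrite lee_fin; exact/lefP/ndf.
rewrite [X in limn X](_ : _ =
    (fun n => \int[mu]_x (f_ n (X x) * g x)%:E)).
  rewrite -monotone_convergence//.
  - apply: eq_integral => x _; apply/esym/cvg_lim => //.
    under eq_fun do rewrite EFinM; rewrite EFinM.
    by apply: cvgeZr => //; exact: cvgf.
  - by move=> n; apply/measurable_EFinP; apply: measurable_funM.
  - by move=> n x _; rewrite lee_fin mulr_ge0.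
  - move=> x _ m n mn; rewrite lee_fin ler_wpM2r//; exact/lefP/ndf.
apply/funext => n.
(* A simple function is a finite combination of indicators of its level sets, and for the indicator
   of [A] the claim is [muXA] at [A]. *)
transitivity (\sum_(k \in range (f_ n))
    \int[nu]_y (k * \1_(f_ n @^-1` [set k]) y)%:E).
  under eq_integral do rewrite fimfunE -fsumEFin//.
  rewrite ge0_integral_fsum//.
  - by move=> y; exact/measurable_EFinP/measurable_funM.
  - by move=> y x _; rewrite nnfun_muleindic_ge0.
transitivity (\sum_(k \in range (f_ n))
    \int[mu]_x (k * \1_(f_ n @^-1` [set k]) (X x) * g x)%:E); last first.
  rewrite -ge0_integral_fsum//.
  - apply: eq_integral => x _; rewrite fsumEFin//; congr EFin.
    by rewrite [X in (X * _)%R]fimfunE mulr_fsuml.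
  - move=> k; apply/measurable_EFinP; apply: measurable_funM => //.
    apply: measurable_funM => //.
    by apply: mindX; exact: measurable_funPTI.
  - move=> k x _; rewrite EFinM mule_ge0 ?lee_fin//.
    exact: nnfun_muleindic_ge0.
apply: eq_fsbigr => k; rewrite inE => -[y _ <-{k}].
set A := f_ n @^-1` [set f_ n y]; have mA : measurable A by exact: measurable_funPTI.
under [RHS]eq_integral do rewrite -mulrA EFinM.
under [LHS]eq_integral do rewrite EFinM.
have mEindX : measurable_fun [set: T] (fun x => (\1_A (X x) * g x)%:E).
  by apply/measurable_EFinP; apply: measurable_funM => //; exact: mindX.
have mEind : measurable_fun [set: U] (fun y => (\1_A y)%:E : \bar R).
  by apply/measurable_EFinP; exact: measurable_indic.
have f_ge0 : 0 <= (f_ n y)%:E by rewrite lee_fin.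
rewrite !ge0_integralZl// => [|x _]; last by rewrite lee_fin mulr_ge0.
rewrite integral_indic// setIT -muXA//; congr (_ * _).
rewrite integral_mkcond; apply: eq_integral => x _.
have XA_E : (x \in X @^-1` A) = (X x \in A) by apply/idP/idP; rewrite !inE.
by rewrite patchE XA_E indicE; case: ifPn => _; rewrite ?mul1r// mul0r.
Qed.

End density_transfer.

(** * Means of products of functions of independent variables *)

Section independent_products.
Context d (T : measurableType d) (R : realType) (P : probability T R).
Context (I : finType) (X : I -> {RV P >-> R}).
Hypothesis indepX : mutually_independent X.

Let measurable_prod (A : {pred I}) (f : I -> R -> R) :
  (forall i, measurable_fun setT (f i)) ->
  measurable_fun [set: T] (fun x => \prod_(i in A) f i (X i x)).
Proof.
move=> mf; under eq_fun do rewrite -big_filter; apply: measurable_prod => i _.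
exact: measurableT_comp.
Qed.

(** Independence speaks of indicators only. The functions are released from being indicators one
    index at a time, by induction on the number of arbitrary ones. *)
Lemma ge0_integral_prod_indep (f : I -> R -> R) :
  (forall i, measurable_fun setT (f i)) -> (forall i y, 0 <= f i y) ->
  (forall i, \int[P]_x (f i (X i x))%:E < +oo)%E ->
  (\int[P]_x (\prod_i f i (X i x))%:E = \prod_i \int[P]_x (f i (X i x))%:E)%E.
Proof.
(* [J] contains the indices whose function may be arbitrary; outside [J] every function is an
   indicator. *)
suff H (n : nat) (J : {set I}) (g : I -> R -> R) : (#|J| <= n)%N ->
    (forall i, measurable_fun setT (g i)) -> (forall i y, 0 <= g i y)%R ->
    (forall i, \int[P]_x (g i (X i x))%:E < +oo)%E ->
    (forall i, i \notin J -> exists2 A : set R, measurable A & g i = \1_A) ->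
    (\int[P]_x (\prod_i g i (X i x))%:E =
     \prod_i \int[P]_x (g i (X i x))%:E)%E.
  by move=> mf f0 foo; apply: (H #|I| [set: I]%SET) => //;
    [exact: max_card|move=> i; rewrite inE].
elim: n J g => [|n IHn] J g.
  rewrite leqn0 cards_eq0 => /eqP -> _ _ _ gA.
  have /choice[A gAE] : forall i, exists A : set R, measurable A /\ g i = \1_A.
    by move=> i; have [|A mA ->] := gA i; [rewrite inE|exists A].
  have mA i : measurable (A i) by case: (gAE i).
  have mXA i : measurable (X i @^-1` A i) by exact: measurable_funPTI.
  (* A product of indicators is the indicator of an intersection, whose probability factors by
     independence. *)
  transitivity (P (\bigcap_(i in [set` [set: I]%SET]) (X i @^-1` A i))).
    rewrite -[in RHS](setIT (\bigcap_(i in _) _)) -integral_indic//; last first.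
      by apply: fin_bigcap_measurable => //; exact: finite_finset.
    apply: eq_integral => x _; congr EFin.
    under eq_bigr do rewrite (gAE _).2 indicE.
    rewrite indicE -natr_prod; congr (_%:R).
    apply/esym; case: (boolP (x \in _)).
      rewrite inE => xA; rewrite big1// => i _.
      by rewrite mem_set//; apply: xA => /=; rewrite inE.
    rewrite notin_setE => /existsNP[i]/not_implyP[_ nA].
    by rewrite (bigD1 i)//= memNset// mul0n.
  rewrite indepX//.
  under eq_bigl do rewrite inE.
  apply: eq_bigr => i _; rewrite -[in LHS](setIT (X i @^-1` _)) -integral_indic//.
  by apply: eq_integral => x _; rewrite (gAE i).2.
move=> Jn mg g0 goo gA.
have [J0|[i iJ]] := set_0Vmem J.
  by apply: (IHn J) => //; rewrite J0 cards0.
pose c : \bar R := (\prod_(j | j != i) \int[P]_x (g j (X j x))%:E)%E.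
have c0 : (0 <= c)%E.
  by apply: prode_ge0 => j _; apply: integral_ge0 => x _; rewrite lee_fin.
(* Finiteness of the other means makes [c] usable as a real scaling factor in [mscale]. *)
have cfin : c \is a fin_num.
  apply: prode_fin_num => j _; rewrite ge0_fin_numE//.
  by apply: integral_ge0 => x _; rewrite lee_fin.
have fc0 : 0 <= fine c by exact: fine_ge0.
rewrite [RHS](bigD1 i)//= -/c.
under eq_integral do rewrite (bigD1 i)//=.
(* The product of the other factors is taken as a density with respect to [P]. The image under [X i]
   of the resulting measure is [c] times the law of [X i]: its value at [A] is the induction
   hypothesis for the family [h], where the [i]-th function becomes [\1_A]. *)
rewrite (ge0_integral_transfer (X := X i)
  (nu := mscale (NngNum fc0) (distribution P (X i)))
  (g := fun x => \prod_(j | j != i) g j (X j x)))//; last 3 first.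
- exact: measurable_prod.
- by move=> x; apply: prodr_ge0.
- move=> A mA.
  have [h [hi hj]] : exists h : I -> R -> R,
      h i = \1_A /\ forall j, j != i -> h j = g j.
    exists (fun j => if j == i then \1_A else g j).
    by split=> [|j /negPf ->]; rewrite ?eqxx.
  have PA : (\int[P]_x (\1_A (X i x))%:E = P (X i @^-1` A))%E.
    rewrite -[in RHS](setIT (X i @^-1` A)) -integral_indic//.
    exact: measurable_funPTI.
  transitivity (\int[P]_x (\prod_j h j (X j x))%:E)%E.
    rewrite integral_mkcond; apply: eq_integral => x _.
    have XA_E : (x \in X i @^-1` A) = (X i x \in A).
      by apply/idP/idP; rewrite !inE.
    rewrite patchE XA_E [in RHS](bigD1 i)//= hi indicE.
    under [in RHS]eq_bigr do rewrite hj//.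
    by case: ifPn => _; rewrite ?mul1r// mul0r.
  rewrite (IHn (J :\ i)%SET h).
  - rewrite (bigD1 i)//= hi PA.
    under eq_bigr do rewrite hj//.
    by rewrite /mscale/= fineK// muleC.
  - by move: Jn; rewrite (cardsD1 i) iJ.
  - move=> j; have [->|/hj->//] := eqVneq j i.
    by rewrite hi; exact: measurable_indic.
  - by move=> j y; have [->|/hj->//] := eqVneq j i; rewrite hi.
  - move=> j; have [->|/hj->//] := eqVneq j i; rewrite hi PA.
    by rewrite (le_lt_trans (probability_le1 P _)) ?ltry//; exact: measurable_funPTI.
  - move=> j; rewrite !inE negb_and negbK.
    have [->|ji /= jJ] := eqVneq j i; first by exists A.
    by rewrite hj//; exact: gA.
rewrite ge0_integral_mscale//=; last 2 first.
- exact/measurable_EFinP.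
- by move=> x _; rewrite lee_fin.
rewrite fineK// muleC ge0_integral_distribution//.
  exact/measurable_EFinP.
by move=> y; rewrite lee_fin.
Qed.

Let integrable_funrposneg (f : I -> R -> R) i (b : bool) :
  P.-integrable setT (fun x => (f i (X i x))%:E) ->
  P.-integrable setT (fun x => ((if b then (f i)^\- else (f i)^\+) (X i x))%:E).
Proof.
move=> intf; case: b.
  exact: (integrable_funrneg measurableT intf).
exact: (integrable_funrpos measurableT intf).
Qed.

(** The absolute value of the product is a product of absolute values, so its mean is a finite
    product of finite means. *)
Lemma integrable_prod_indep (f : I -> R -> R) :
  (forall i, measurable_fun setT (f i)) ->
  (forall i, P.-integrable setT (fun x => (f i (X i x))%:E)) ->
  P.-integrable setT (fun x => (\prod_i f i (X i x))%:E).
Proof.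
move=> mf intf; apply/integrableP; split.
  by apply/measurable_EFinP; exact: measurable_prod.
have nfoo i : (\int[P]_x (`|f i (X i x)|)%:E < +oo)%E.
  by have /integrableP[_] := intf i.
under eq_integral do rewrite abse_EFin normr_prod.
rewrite (ge0_integral_prod_indep (f := fun i y => `|f i y|))//.
- rewrite -ge0_fin_numE.
    apply: prode_fin_num => i _; rewrite ge0_fin_numE//.
    by apply: integral_ge0 => x _; rewrite lee_fin.
  by apply: prode_ge0 => i _; apply: integral_ge0 => x _; rewrite lee_fin.
- by move=> i; exact: measurableT_comp.
Qed.

Lemma Rintegral_sum (J : Type) (s : seq J) (Q : pred J) (h : J -> T -> R) :
  (forall j, P.-integrable setT (fun x => (h j x)%:E)) ->
  \int[P]_x (\sum_(j <- s | Q j) h j x) =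
  \sum_(j <- s | Q j) \int[P]_x h j x.
Proof.
move=> inth; rewrite /Rintegral.
under eq_integral do rewrite -sumEFin.
rewrite integral_sum// -[RHS]/(fine (_%:E)) -sumEFin; congr fine.
by apply: eq_bigr => j _; rewrite fineK//; exact: integrable_fin_num.
Qed.

(** Splitting each factor into positive and negative parts turns the product into a signed sum of
    nonnegative products, to which the nonnegative case applies. *)
Lemma Rintegral_prod_indep (f : I -> R -> R) :
  (forall i, measurable_fun setT (f i)) ->
  (forall i, P.-integrable setT (fun x => (f i (X i x))%:E)) ->
  \int[P]_x (\prod_i f i (X i x)) = \prod_i \int[P]_x f i (X i x).
Proof.
move=> mf intf.
(* [true] selects the negative part, so that the part enters with sign [(-1) ^+ b]. *)
pose F i (b : bool) := if b then (f i)^\- else (f i)^\+.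
have mF i b : measurable_fun setT (F i b).
  by case: b; [exact: measurable_funrneg|exact: measurable_funrpos].
have F0 i b y : 0 <= F i b y by case: b; rewrite /F/= le_max lexx orbT.
have intF i b : P.-integrable setT (fun x => (F i b (X i x))%:E).
  exact: integrable_funrposneg.
have Ffin i b : (\int[P]_x (F i b (X i x))%:E)%E \is a fin_num.
  exact: integrable_fin_num.
have fE i y : f i y = \sum_(b : bool) (-1) ^+ b * F i b y.
  by rewrite big_bool/= expr1 expr0 mul1r mulN1r addrC -[in LHS](funrposBneg (f i)).
have prodE (h : {ffun I -> bool}) :
    \int[P]_x (\prod_i F i (h i) (X i x)) = \prod_i \int[P]_x F i (h i) (X i x).
  rewrite /Rintegral (ge0_integral_prod_indep (f := fun i => F i (h i)))//; last first.
    by move=> i; exact: integrable_lty.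
  rewrite -[RHS]/(fine (_%:E)) -prodEFin; congr fine.
  by apply: eq_bigr => i _; rewrite fineK.
have intprodF (h : {ffun I -> bool}) :
    P.-integrable setT (fun x => (\prod_i F i (h i) (X i x))%:E).
  exact: (integrable_prod_indep (f := fun i => F i (h i))).
(* Distributivity gives one term for each choice [h] of parts; the same identity, read backwards,
   reassembles the product of means. *)
transitivity (\sum_(h : {ffun I -> bool}) (\prod_i (-1) ^+ h i) *
   \int[P]_x (\prod_i F i (h i) (X i x))).
  under eq_Rintegral do under eq_bigr do rewrite fE.
  under eq_Rintegral do rewrite bigA_distr_bigA/=.
  rewrite Rintegral_sum.
    apply: eq_bigr => h _; rewrite -RintegralZl//; last exact: intprodF.
    by apply: eq_Rintegral => x _; rewrite big_split.
  move=> h; under eq_fun do rewrite big_split EFinM.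
  exact: integrableZl.
under [LHS]eq_bigr do rewrite prodE -big_split.
rewrite -(bigA_distr_bigA (fun i (b : bool) => (-1) ^+ b * \int[P]_x F i b (X i x))).
apply: eq_bigr => i _.
rewrite big_bool/= expr1 expr0 mul1r mulN1r addrC -RintegralB//;
  [|exact: (intF i false)|exact: (intF i true)].
by apply: eq_Rintegral => x _; rewrite fE big_bool/= expr1 expr0 mul1r mulN1r addrC.
Qed.

End independent_products.

(** * Hermite polynomials and the Gaussian density on the real line *)

Section gaussian_polynomials.
Context {R : realType}.
Implicit Types (p q : {poly R}) (x : R).
Local Notation mu := (@lebesgue_measure R).
Local Notation phi := (@normal_pdf R 0 1).

Lemma exprn_le_expR x n : 0 <= x -> x ^+ n <= n`!%:R * expR x.
Proof.
move=> x0; case: n => [|n].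
  by rewrite expr0 fact0 mul1r -[leLHS]expR0 ler_expR.
rewrite mulrC -ler_pdivrMr ?ltr0n ?fact_gt0//.
by apply: le_trans (expR_ge1Dxn n x0); rewrite lerDr.
Qed.

Lemma normr_horner_le_expR p :
  exists2 C, 0 <= C & forall x, `|p.[x]| <= C * expR `|x|.
Proof.
exists (\sum_(i < size p) `|p`_i| * i`!%:R) => [|x].
  by apply: sumr_ge0 => i _; rewrite mulr_ge0.
rewrite horner_coef mulr_suml (le_trans (ler_norm_sum _ _ _))//.
apply: ler_sum => i _; rewrite normrM normrX -mulrA ler_wpM2l//.
exact: exprn_le_expR.
Qed.

Lemma normal_pdf01E x : phi x = normal_peak 1 * expR (- x ^+ 2 / 2).
Proof.
by rewrite normal_pdfE ?oner_neq0// /normal_fun subr0 expr1n.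
Qed.

(** The wider Gaussian density, of standard deviation 2, is integrable and bounded; this one
    domination therefore serves both integrability and decay at infinity. *)
Lemma normr_horner_normal_pdf_le p : exists2 C, 0 <= C &
  forall x, `|p.[x] * phi x| <= C * normal_pdf 0 2 x.
Proof.
have [C C0 pC] := normr_horner_le_expR p.
have pk2 : 0 < normal_peak (2 : R) by rewrite normal_peak_gt0// pnatr_eq0.
have pk1 := @normal_peak_ge0 R 1.
(* [2 / 3] is the maximum of [y - y ^+ 2 / 2 + y ^+ 2 / 8], attained at [y = 4 / 3]; the quotient of
   peaks exchanges the normalizing constants. *)
exists (C * expR (2 / 3) * normal_peak 1 / normal_peak 2) => [|x].
  by rewrite !mulr_ge0// ?expR_ge0// invr_ge0 ltW.
rewrite normrM (ger0_norm (normal_pdf_ge0 _ _ _)) normal_pdf01E.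
rewrite normal_pdfE ?pnatr_eq0// /normal_fun subr0.
rewrite [leRHS](_ : _ = (C * normal_peak 1) *
    (expR (2 / 3) * expR (- x ^+ 2 / (2 ^+ 2 *+ 2)))); last first.
  by field; rewrite gt_eqF.
apply: (@le_trans _ _ (C * expR `|x| * (normal_peak 1 * expR (- x ^+ 2 / 2)))).
  by rewrite ler_wpM2r// mulr_ge0// expR_ge0.
rewrite [leLHS](_ : _ = C * normal_peak 1 * (expR `|x| * expR (- x ^+ 2 / 2))).
  rewrite ler_wpM2l ?mulr_ge0// -!expRD ler_expR.
  rewrite -[x ^+ 2]real_normK ?num_real//; move: `|x| => y.
  rewrite -subr_ge0 [leRHS](_ : _ = 3 / 8 * (y - 4 / 3) ^+ 2); last by field.
  by rewrite mulr_ge0// sqr_ge0.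
by ring.
Qed.

Lemma measurable_horner p : measurable_fun [set: R] (fun x => p.[x]).
Proof. by apply: continuous_measurable_fun; exact: continuous_horner. Qed.

Lemma measurable_horner_normal_pdf p :
  measurable_fun [set: R] (fun x => p.[x] * phi x).
Proof.
apply: measurable_funM; first exact: measurable_horner.
exact: measurable_normal_pdf.
Qed.

Lemma integrable_horner_normal_pdf p :
  mu.-integrable setT (fun x => (p.[x] * phi x)%:E).
Proof.
have [C C0 pC] := normr_horner_normal_pdf_le p.
have intC : mu.-integrable setT (fun x => (C * normal_pdf 0 2 x)%:E).
  under eq_fun do rewrite EFinM.
  by apply: integrableZl => //; exact: integrable_normal_pdf.
apply: le_integrable intC => //.
- by apply/measurable_EFinP; exact: measurable_horner_normal_pdf.
- by move=> x _; rewrite !abse_EFin lee_fin (le_trans (pC x))// ler_norm.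
Qed.

Lemma cvg_horner_normal_pdf p (u : nat -> R) : (forall n, `|u n| = n.+1%:R) ->
  p.[u n] * phi (u n) @[n --> \oo] --> (0 : R).
Proof.
(* Bounding ['X * p] instead of [p] gains a factor [|u n| = n.+1], hence decay like [D / n.+1]. *)
move=> un; have [C C0 pC] := normr_horner_normal_pdf_le ('X * p).
pose D := C * normal_peak 2.
have harmonic0 k : (k * harmonic n : R) @[n --> \oo] --> (0 : R).
  have := cvgM (cvg_cst k) (@cvg_harmonic R); rewrite mulr0; exact.
apply: (squeeze_cvgr _ (harmonic0 (- D)) (harmonic0 D)).
apply: nearW => n; rewrite mulNr -ler_norml /harmonic/= ler_pdivlMr ?ltr0n//.
have := pC (u n); rewrite hornerM hornerX -mulrA normrM un mulrC => /le_trans; apply.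
by rewrite ler_wpM2l// normal_pdf_ub// pnatr_eq0.
Qed.

Lemma is_derive_normal_pdf01 x :
  is_derive x (1 : R) phi (- x * phi x).
Proof.
have -> : phi = (fun x => normal_peak 1 * expR (- x ^+ 2 / 2)).
  by apply/funext => y; exact: normal_pdf01E.
apply: is_derive_eq.
by rewrite /GRing.scale/=; field.
Qed.

(* [- p * phi] is an antiderivative of the integrand and vanishes at infinity. *)
Lemma Rintegral_horner_normal_pdf_stein p :
  \int[mu]_x (('X * p - p^`()).[x] * phi x) = 0.
Proof.
set q := 'X * p - p^`().
pose F x := - (p.[x] * phi x).
have dF x : is_derive x (1 : R) F (q.[x] * phi x).
  have dphi := is_derive_normal_pdf01 x.
  apply: is_derive_eq.
  rewrite /q hornerD hornerN hornerM hornerX /GRing.scale/=.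
  by ring.
have cq : continuous (fun x => q.[x] * phi x).
  move=> x; apply: cvgM; first exact: continuous_horner.
  by apply: continuous_normal_pdf; exact: oner_neq0.
have cF : continuous F.
  by move=> x; apply/differentiable_continuous/derivable1_diffP; have [] := dF x.
(* The endpoint [n.+1] keeps the interval nondegenerate for [n = 0], as the fundamental theorem of
   calculus requires. *)
pose I (n : nat) : set R := `[- n.+1%:R, n.+1%:R]%classic.
have intI n : (\int[mu]_(x in I n) (q.[x] * phi x)%:E =
    (F n.+1%:R - F (- n.+1%:R))%:E)%E.
  rewrite (continuous_FTC2 (F := F)).
  - by rewrite EFinB.
  - by apply: (@lt_trans _ _ 0); rewrite ?oppr_lt0 ltr0Sn.
  - exact: continuous_subspaceT.
  - split=> [x _||].
    + by have [] := dF x.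
    + exact/cvg_at_right_filter/cF.
    + exact/cvg_at_left_filter/cF.
  - by move=> x _; rewrite derive1E derive_val.
(* Dominated convergence: each [x] lies in all [I n] from some rank on, and the absolute value of
   the full integrand dominates. *)
have cvgI : (\int[mu]_(x in I n) (q.[x] * phi x)%:E)%E @[n --> \oo] -->
    (\int[mu]_x (q.[x] * phi x)%:E)%E.
  have intq := integrable_horner_normal_pdf q.
  pose h n := (fun x => (q.[x] * phi x)%:E) \_ (I n).
  rewrite (_ : (fun n => _) = (fun n => \int[mu]_x h n x)%E); last first.
    by apply/funext => n; rewrite integral_mkcond.
  apply: (@dominated_cvg _ _ _ mu setT measurableT h _
    (fun x => `|(q.[x] * phi x)%:E|%E)) => //.
  - move=> n; apply/(measurable_restrictT _ _).1 => //.
      exact: measurable_itv.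
    apply: measurable_funTS; apply/measurable_EFinP.
    exact: measurable_horner_normal_pdf.
  - move=> x _; apply: cvg_near_cst; near=> n.
    have xn : `|x| <= n.+1%:R.
      by rewrite (@le_trans _ _ n%:R)// ?ler_nat//; near: n; exact: nbhs_infty_ger.
    by rewrite /h patchE mem_set// /I/= in_itv/= -ler_norml.
  - exact: integrable_abse.
  - move=> n x _; rewrite /h patchE.
    by case: ifPn => _; rewrite ?abse0 ?lexx ?abse_ge0.
have cvg0 : (F n.+1%:R - F (- n.+1%:R)) @[n --> \oo] --> (0 : R).
  rewrite -[X in _ --> X]subr0 -[X in X - _]oppr0 -[X in _ - X]oppr0.
  apply: cvgB; apply: cvgN; apply: cvg_horner_normal_pdf => n;
    by rewrite ?normrN normr_nat.
rewrite /Rintegral -(cvg_lim _ cvgI)//.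
under eq_fun do rewrite intI.
have cvgF : cvgn (fun n : nat => F n.+1%:R - F (- n.+1%:R)).
  by apply/cvg_ex; exists 0.
by rewrite (EFin_lim cvgF)/=; apply/cvg_lim.
Unshelve. all: by end_near. Qed.

Let gmean p := \int[mu]_x (p.[x] * phi x).

Let gmeanD p q : gmean (p + q) = gmean p + gmean q.
Proof.
rewrite /gmean -RintegralD//; [|exact: integrable_horner_normal_pdf..].
by apply: eq_Rintegral => x _; rewrite hornerD mulrDl.
Qed.

Let gmeanZ (c : R) p : gmean (c *: p) = c * gmean p.
Proof.
rewrite /gmean -RintegralZl//; last exact: integrable_horner_normal_pdf.
by apply: eq_Rintegral => x _; rewrite hornerZ mulrA.
Qed.

Let gmeanC (c : R) : gmean c%:P = c.
Proof.
rewrite -alg_polyC gmeanZ /gmean /Rintegral.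
under eq_integral do rewrite hornerC mul1r.
by rewrite integral_normal_pdf mulr1.
Qed.

(** With [H = hermite R n], the recurrence gives [hermite R n.+1 * q = ('X * (H * q) - (H * q)^]())
    + H * q^[()]. The bracket has mean zero by Stein's identity, so each step moves one derivative
    onto [q]. *)
Let gmean_hermite_mul n q : gmean (hermite R n * q) = gmean q^`(n).
Proof.
elim: n q => [|n IHn] q; first by rewrite /= mul1r.
rewrite derivSn -IHn /=.
rewrite [X in gmean X](_ : _ = ('X * (hermite R n * q) -
  (hermite R n * q)^`()) + hermite R n * q^`()); last first.
  by rewrite derivM; ring.
by rewrite gmeanD [X in X + _]Rintegral_horner_normal_pdf_stein add0r.
Qed.

Lemma size_hermite n : size (hermite R n) = n.+1.
Proof.
elim: n => [|n IHn] /=; first by rewrite size_poly1.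
have H0 : hermite R n != 0 by rewrite -size_poly_gt0 IHn.
have XH : size ('X * hermite R n) = n.+2 by rewrite mulrC size_mulX// IHn.
rewrite size_polyDl ?XH// size_polyN ltnS -IHn ltnW//.
exact: lt_size_deriv.
Qed.

Lemma lead_coef_hermite n : lead_coef (hermite R n) = 1.
Proof.
elim: n => [|n IHn] /=; first by rewrite lead_coef1.
have H0 : hermite R n != 0 by rewrite -size_poly_gt0 size_hermite.
rewrite ['X * _]mulrC lead_coefDl ?lead_coefMX// size_polyN size_mulX//.
by rewrite ltnS ltnW// lt_size_deriv.
Qed.

(** [hermite R n] is monic of degree [n]. *)
Lemma derivn_hermite n m : (n <= m)%N ->
  (hermite R n)^`(m) = (if n == m then n`!%:R else 0)%:P.
Proof.
move=> nm; apply/polyP => i; rewrite coef_derivn coefC.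
case: i => [|i] /=; last first.
  by rewrite nth_default ?mul0rn// size_hermite addnS ltnS (leq_trans nm)// leq_addr.
rewrite addn0 ffactnn; have [<-|nm'] := eqVneq n m.
  by rewrite -[X in _`_X]/(n.+1.-1) -size_hermite -lead_coefE lead_coef_hermite.
by rewrite nth_default ?mul0rn// size_hermite ltn_neqAle nm'.
Qed.

Let gmean_hermiteM n m :
  gmean (hermite R n * hermite R m) = if n == m then n`!%:R else 0.
Proof.
wlog nm : n m / (n <= m)%N.
  move=> H; have [|/ltnW] := leqP n m; first exact: H.
  by move=> /H; rewrite mulrC eq_sym; case: eqP => [->|].
(* The factor of higher index [m] is traded for derivatives, so that the [m]-th derivative falls on
   degree [n <= m] and is constant. *)
rewrite mulrC gmean_hermite_mul derivn_hermite// gmeanC.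
Qed.

Lemma Rintegral_hermite_normalizedM n m :
  \int[mu]_x ((hermite_normalized R n * hermite_normalized R m).[x] * phi x) =
  (n == m)%:R.
Proof.
rewrite -/(gmean _) /hermite_normalized -scalerAl -scalerAr scalerA gmeanZ.
rewrite gmean_hermiteM; case: eqP => [->|_]; last by rewrite mulr0.
have : (0 : R) < m`!%:R by rewrite ltr0n fact_gt0.
rewrite -sqrtr_gt0 => m0.
rewrite -[X in _ * X]sqr_sqrtr ?ler0n// -invfM -expr2 mulVf// expf_neq0//.
Qed.

End gaussian_polynomials.

(** * Polynomials of one standard Gaussian variable *)

Section gaussian_variable.
Context d (T : measurableType d) (R : realType) (P : probability T R).
Context (X : {RV P >-> R}).
Hypothesis gaussX : forall A : set R, measurable A ->
  distribution P X A = normal_prob 0 1 A.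
Local Notation mu := (@lebesgue_measure R).
Local Notation phi := (@normal_pdf R 0 1).

Let ge0_integral_gaussian (f : R -> R) : measurable_fun setT f ->
  (forall y, 0 <= f y) ->
  (\int[P]_w (f (X w))%:E = \int[mu]_y (f y * phi y)%:E)%E.
Proof.
move=> mf f0.
(* With the identity map, the transfer says that the law of [X] has density [phi] with respect to
   Lebesgue measure. *)
rewrite (ge0_integral_transfer (mu := mu) (nu := distribution P X) (X := id))//.
- rewrite ge0_integral_distribution//; exact/measurable_EFinP.
- exact: measurable_normal_pdf.
- by move=> y; exact: normal_pdf_ge0.
- by move=> A mA; apply/esym; exact: gaussX.
Qed.

Lemma integrable_horner_gaussian (p : {poly R}) :
  P.-integrable setT (fun w => (p.[X w])%:E).
Proof.
apply/integrableP; split.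
  apply/measurable_EFinP; apply: (measurableT_comp (measurable_horner p)) => //.
under eq_integral do rewrite abse_EFin.
rewrite (ge0_integral_gaussian (f := fun y => `|p.[y]|))//; last first.
  by apply: measurableT_comp => //; exact: measurable_horner.
have /integrableP[_] := integrable_horner_normal_pdf p.
by under eq_integral do rewrite abse_EFin normrM (ger0_norm (normal_pdf_ge0 _ _ _)).
Qed.

Lemma Rintegral_horner_gaussian (p : {poly R}) :
  \int[P]_w p.[X w] = \int[mu]_y (p.[y] * phi y).
Proof.
pose f y := p.[y].
have mf : measurable_fun setT f by exact: measurable_horner.
have intf := integrable_horner_normal_pdf p.
have mphi : measurable_fun setT phi by exact: measurable_normal_pdf.
have phi0 y : 0 <= phi y by exact: normal_pdf_ge0.
have normfE y : f^\+ y + f^\- y = `|f y|.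
  exact: (congr1 (@^~ y) (funrposDneg f)).
have le_posf y : f^\+ y <= `|f y| by rewrite -normfE lerDl funrneg_ge0.
have le_negf y : f^\- y <= `|f y| by rewrite -normfE lerDr funrpos_ge0.
(* The transfer covers nonnegative functions only; both parts of [f] are dominated by its absolute
   value, so their integrals may be subtracted. *)
have int_part (g : R -> R) : measurable_fun setT g -> (forall y, 0 <= g y) ->
    (forall y, g y <= `|f y|) -> mu.-integrable setT (fun y => (g y * phi y)%:E).
  move=> mg g0 gf; apply: le_integrable intf => //.
    by apply/measurable_EFinP; exact: measurable_funM.
  by move=> y _; rewrite !abse_EFin lee_fin !normrM ler_wpM2r// ger0_norm.
have pos0 y : 0 <= f^\+ y by exact: funrpos_ge0.
have neg0 y : 0 <= f^\- y by exact: funrneg_ge0.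
have mpos : measurable_fun setT f^\+ by exact: measurable_funrpos.
have mneg : measurable_fun setT f^\- by exact: measurable_funrneg.
have intfX := integrable_horner_gaussian p.
transitivity (\int[P]_w f^\+ (X w) - \int[P]_w f^\- (X w)).
  rewrite -RintegralB//.
  - apply: eq_Rintegral => w _.
    by rewrite -[LHS](congr1 (@^~ (X w)) (funrposBneg f)).
  - exact: (integrable_funrpos measurableT intfX).
  - exact: (integrable_funrneg measurableT intfX).
rewrite /Rintegral !ge0_integral_gaussian// -/(Rintegral _ _ _) -/(Rintegral _ _ _).
rewrite -RintegralB//; [|exact: int_part..].
apply: eq_Rintegral => y _; rewrite -mulrBl; congr (_ * _).
exact: (congr1 (@^~ y) (funrposBneg f)).
Qed.

End gaussian_variable.

(** * Orthonormality of the [psi g] and covariance of finite expansions *)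

Section gaussian_vector.
Context d (T : measurableType d) (R : realType) (P : probability T R) (s : nat).
Context (eta : 'I_s -> {RV P >-> R}).
Hypothesis eta_gauss : standard_gaussian_vector eta.
Implicit Types (g h : multi_index s).

Local Notation psi_eta g := (fun w => psi g (fun i => eta i w)).

Let psiM g h w : psi_eta g w * psi_eta h w =
  \prod_i (hermite_normalized R (g i) * hermite_normalized R (h i)).[eta i w].
Proof. by rewrite /psi -big_split; apply: eq_bigr => i _; rewrite hornerM. Qed.

Lemma psi_e0 (r : nat) (x : 'I_r -> R) : psi (e0 r) x = 1.
Proof.
rewrite /psi big1// => i _; rewrite ffunE /hermite_normalized fact0 sqrtr1 invr1.
by rewrite scale1r hornerC.
Qed.

Lemma integrable_psiM g h :
  P.-integrable setT (fun w => (psi_eta g w * psi_eta h w)%:E).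
Proof.
have [gauss indep] := eta_gauss.
under eq_fun do rewrite psiM.
apply: (integrable_prod_indep indep
  (f := fun i y => (hermite_normalized R (g i) * hermite_normalized R (h i)).[y])).
- by move=> i; exact: measurable_horner.
- by move=> i; apply: integrable_horner_gaussian; exact: gauss.
Qed.

Lemma Rintegral_psiM g h : \int[P]_w (psi_eta g w * psi_eta h w) = (g == h)%:R.
Proof.
have [gauss indep] := eta_gauss.
under eq_Rintegral do rewrite psiM.
rewrite (Rintegral_prod_indep indep
  (f := fun i y => (hermite_normalized R (g i) * hermite_normalized R (h i)).[y])).
- under eq_bigr => i _.
    rewrite (Rintegral_horner_gaussian (gauss i)) Rintegral_hermite_normalizedM.
    over.
  (* Distinct multi-indices differ in some coordinate, whose factor is zero. *)
  have [<-|/eqP gh] := eqVneq g h; first by rewrite big1// => i _; rewrite eqxx.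
  have [i ghi] : exists i, g i != h i.
    by apply/existsP; rewrite -negb_forall; apply/negP => /forallP gh';
      apply: gh; apply/ffunP => i; exact/eqP.
  by rewrite (bigD1 i)//= (negPf ghi) mul0r.
- by move=> i; exact: measurable_horner.
- by move=> i; apply: integrable_horner_gaussian; exact: gauss.
Qed.

Lemma integrable_psi g : P.-integrable setT (fun w => (psi_eta g w)%:E).
Proof.
have := integrable_psiM g (e0 s).
by under eq_fun do rewrite psi_e0 mulr1.
Qed.

(** This is orthonormality against [psi (e0 s)], the constant 1. *)
Lemma Rintegral_psi g : \int[P]_w psi_eta g w = (g == e0 s)%:R.
Proof.
by rewrite -Rintegral_psiM; under [RHS]eq_Rintegral do rewrite psi_e0 mulr1.
Qed.

(** The mean of an expansion is its coefficient at [e0 s], so subtracting the product of means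
    deletes exactly the diagonal term at [e0 s]. *)
Lemma covariance_sum_psi (D : seq (multi_index s)) (a b : multi_index s -> R) :
  uniq D -> e0 s \in D ->
  covariance P (fun w => \sum_(g <- D) a g * psi_eta g w)
    (fun w => \sum_(g <- D) b g * psi_eta g w) =
  (\sum_(g <- D | g != e0 s) a g * b g)%:E.
Proof.
move=> uD D0.
have intZ (c : multi_index s -> R) g :
    P.-integrable setT (fun w => (c g * psi_eta g w)%:E).
  under eq_fun do rewrite EFinM.
  by apply: integrableZl => //; exact: integrable_psi.
have intS c : P.-integrable setT (fun w => (\sum_(g <- D) c g * psi_eta g w)%:E).
  under eq_fun do rewrite -sumEFin.
  by apply: (integrable_sum measurableT) => g _; exact: intZ.
have meanS c : (\int[P]_w (\sum_(g <- D) c g * psi_eta g w)%:E = (c (e0 s))%:E)%E.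
  rewrite -[LHS]fineK ?integrable_fin_num// -/(Rintegral _ _ _).
  rewrite Rintegral_sum//; congr EFin.
  transitivity (\sum_(g <- D) c g * (g == e0 s)%:R).
    apply: eq_bigr => g _; rewrite RintegralZl ?Rintegral_psi//.
    exact: integrable_psi.
  rewrite (bigD1_seq (e0 s))//= eqxx mulr1 big1 ?addr0// => g /negPf ->.
  by rewrite mulr0.
have prodE w : (\sum_(g <- D) a g * psi_eta g w) *
      (\sum_(h <- D) b h * psi_eta h w) =
    \sum_(g <- D) \sum_(h <- D) a g * b h * (psi_eta g w * psi_eta h w).
  rewrite mulr_suml; apply: eq_bigr => g _; rewrite mulr_sumr.
  by apply: eq_bigr => h _; rewrite mulrACA.
have intZ2 g h :
    P.-integrable setT (fun w => (a g * b h * (psi_eta g w * psi_eta h w))%:E).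
  under eq_fun do rewrite EFinM.
  by apply: integrableZl => //; exact: integrable_psiM.
have intS2 g : P.-integrable setT
    (fun w => (\sum_(h <- D) a g * b h * (psi_eta g w * psi_eta h w))%:E).
  under eq_fun do rewrite -sumEFin.
  by apply: (integrable_sum measurableT) => h _; exact: intZ2.
have intprod : P.-integrable setT (fun w => ((\sum_(g <- D) a g * psi_eta g w) *
    (\sum_(h <- D) b h * psi_eta h w))%:E).
  under eq_fun do rewrite prodE -sumEFin.
  by apply: (integrable_sum measurableT) => g _; exact: intS2.
have meanprod : (\int[P]_w ((\sum_(g <- D) a g * psi_eta g w) *
    (\sum_(h <- D) b h * psi_eta h w))%:E = (\sum_(g <- D) a g * b g)%:E)%E.
  rewrite -[LHS]fineK ?integrable_fin_num// -/(Rintegral _ _ _).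
  under eq_Rintegral do rewrite prodE.
  rewrite Rintegral_sum//; congr EFin; apply: eq_big_seq => g gD.
  rewrite Rintegral_sum//.
  transitivity (\sum_(h <- D) a g * b h * (g == h)%:R).
    apply: eq_bigr => h _; rewrite RintegralZl ?Rintegral_psiM//.
    exact: integrable_psiM.
  rewrite (bigD1_seq g)//= eqxx mulr1 big1 ?addr0// => h /negPf.
  by rewrite eq_sym => ->; rewrite mulr0.
rewrite covarianceE;
  [|by apply/Lfun1_integrable; exact: intS..
   |by apply/Lfun1_integrable; exact: intprod].
rewrite unlock meanprod !meanS -EFinM -EFinB; congr EFin.
by rewrite (bigD1_seq (e0 s))//= addrAC subrr add0r.
Qed.

End gaussian_vector.

(** * Padding of multi-indices and of expansions *)

Lemma big_pad (A : Type) (idx : A) (op : Monoid.com_law idx) (r s : nat)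
    (le_rs : (r <= s)%N) (g : multi_index r) (F : 'I_s -> nat -> A) :
  (forall i, F i 0%N = idx) ->
  \big[op/idx]_(i < s) F i (pad s g i) =
  \big[op/idx]_(i < r) F (widen_ord le_rs i) (g i).
Proof.
move=> F0; rewrite (bigID (fun i : 'I_s => (i < r)%N))/=.
(* The positions from [r] on hold 0, where [F] is neutral. *)
rewrite [X in op _ X]big1 ?Monoid.mulm1; last first.
  by move=> i ir; rewrite ffunE insubN.
rewrite (reindex_omap (widen_ord le_rs) (fun i : 'I_s => insub (val i))).
  apply: eq_big => [i|i _] /=; first by rewrite valK eqxx ltn_ord.
  by rewrite ffunE/= valK.
by move=> i ir; rewrite insubT/=; congr Some; exact: val_inj.
Qed.

Lemma psi_pad (R : realType) (r s : nat) (le_rs : (r <= s)%N)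
    (g : multi_index r) (x : 'I_s -> R) :
  psi (pad s g) x = psi g (fun i => x (widen_ord le_rs i)).
Proof.
apply: (big_pad _ le_rs g (F := fun i n => (hermite_normalized R n).[x i])) => i.
by rewrite /hermite_normalized fact0 sqrtr1 invr1 scale1r hornerC.
Qed.

Lemma pad_e0 (r s : nat) : pad s (e0 r) = e0 s.
Proof.
by apply/ffunP => i; rewrite !ffunE; case: insubP => //= j; rewrite ffunE.
Qed.

Lemma total_degree_e0 (r p : nat) : total_degree r p (e0 r).
Proof. by rewrite /total_degree/= big1// => i _; rewrite ffunE. Qed.

Lemma total_degree_pad (r s p q : nat) (g : multi_index r) :
  (r <= s)%N -> (p <= q)%N -> total_degree r p g -> total_degree s q (pad s g).
Proof.
move=> le_rs le_pq; rewrite /total_degree/= => gp.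
by rewrite (big_pad _ le_rs g (F := fun _ n => n))// (leq_trans gp).
Qed.

Section padded_chaos.
Context (R : realType) (r s p q : nat) (le_rs : (r <= s)%N) (le_pq : (p <= q)%N).
Context (c : multi_index r -> R).

Local Notation J := [set pad s g | g in total_degree r p].

(** The test is needed because [unpad] truncates: an index with a nonzero entry past position [r]
    would otherwise receive a coefficient of [c]. It also cuts off degrees above [p], where [c] is
    arbitrary. *)
Definition padded_coef (g : multi_index s) : R :=
  if g \in J then c (unpad le_rs g) else 0.

Let JD : J `<=` total_degree s q.
Proof. by move=> _ [g gp <-]; exact: total_degree_pad gp. Qed.

(** Injectivity of padding carries the sum to its image; the remaining indices have coefficient 0
    and add nothing. The general [F] serves both expansions and sums of squares. *)
Lemma fsbig_padded_coef (F : multi_index s -> R -> R) (A : set (multi_index s)) :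
  (forall g, F g 0 = 0) ->
  \sum_(g \in total_degree r p `&` (@pad r s) @^-1` A) F (pad s g) (c g) =
  \sum_(g \in total_degree s q `&` A) F g (padded_coef g).
Proof.
move=> F0.
transitivity (\sum_(g \in J `&` A) F g (padded_coef g)).
  rewrite (_ : J `&` A =
      @pad r s @` (total_degree r p `&` (@pad r s) @^-1` A)); last first.
    apply/seteqP; split=> [_ [[g gp <-] Ag]|_ [g [gp Ag] <-]]; first by exists g.
    by split => //; exists g.
  rewrite fsbig_image; last by move=> x y _ _; exact: (can_inj (padK le_rs)).
  apply: eq_fsbigr => g; rewrite inE => -[gp _].
  by rewrite /padded_coef mem_set ?padK//; exists g.
apply: fsbig_widen => [g [/JD]//|g [[_ Ag] nJ]].
by rewrite /= /padded_coef memNset// => Jg; apply: nJ.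
Qed.

Lemma chaos_expansion_pad (x : 'I_s -> R) :
  chaos_expansion p c (fun i => x (widen_ord le_rs i)) =
  \sum_(g \in total_degree s q) padded_coef g * psi g x.
Proof.
have := @fsbig_padded_coef (fun g y => y * psi g x) setT.
rewrite preimage_setT !setIT => <- => [|g]; last by rewrite mul0r.
by apply: eq_fsbigr => g _; rewrite (psi_pad le_rs).
Qed.

End padded_chaos.

(** * Correlation of two expansions of different dimensions and degrees *)

Theorem proposition4p3 (R : realType) (d : measure_display)
    (T : measurableType d) (P : probability T R)
    (rH rL pH pL : nat) (rH_gt0 : (0 < rH)%N) (rL_gt0 : (0 < rL)%N)
    (cH : multi_index rH -> R) (cL : multi_index rL -> R)
    (eta : 'I_(maxn rH rL) -> {RV P >-> R})
    (eta_gauss : standard_gaussian_vector eta)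
    (cH_neq0 : exists g, (total_degree rH pH `\ e0 rH) g /\ cH g <> 0)
    (cL_neq0 : exists g, (total_degree rL pL `\ e0 rL) g /\ cL g <> 0) :
  let QH (w : T) : R :=
    chaos_expansion pH cH (fun i => eta (widen_ord (leq_maxl rH rL) i) w) in
  let QL (w : T) : R :=
    chaos_expansion pL cL (fun i => eta (widen_ord (leq_maxr rH rL) i) w) in
  let JH := [set pad (maxn rH rL) g | g in total_degree rH pH] in
  let JL := [set pad (maxn rH rL) g | g in total_degree rL pL] in
  correlation P QH QL =
    (\sum_(g \in (JH `&` JL) `\ e0 (maxn rH rL))
        cH (unpad (leq_maxl rH rL) g) * cL (unpad (leq_maxr rH rL) g))
    / Num.sqrt ((\sum_(g \in total_degree rH pH `\ e0 rH) cH g ^+ 2) *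
                (\sum_(g \in total_degree rL pL `\ e0 rL) cL g ^+ 2)).
Proof.
move=> QH QL JH JL.
set s := maxn rH rL in eta eta_gauss QH QL JH JL *.
(* Both padded expansions live on [total_degree s q], enumerated below by [D]. *)
set q := maxn pH pL.
have le_pH : (pH <= q)%N by exact: leq_maxl.
have le_pL : (pL <= q)%N by exact: leq_maxr.
have [D uD DE] : exists2 D : seq (multi_index s), uniq D &
    total_degree s q = [set` D].
  have [D DE] := (finite_seqP _).1 (finite_total_degree s q).
  exists (undup D); first exact: undup_uniq.
  by rewrite DE; apply/seteqP; split=> g; rewrite /= mem_undup.
have D0 : e0 s \in D.
  by have := total_degree_e0 s q; rewrite DE.
pose aH := padded_coef pH (leq_maxl rH rL) cH.
pose aL := padded_coef pL (leq_maxr rH rL) cL.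
have QHE : QH = fun w => \sum_(g <- D) aH g * psi g (fun i => eta i w).
  apply/funext => w; rewrite fsbig_seq// -DE.
  exact: (chaos_expansion_pad _ le_pH _ (fun i => eta i w)).
have QLE : QL = fun w => \sum_(g <- D) aL g * psi g (fun i => eta i w).
  apply/funext => w; rewrite fsbig_seq// -DE.
  exact: (chaos_expansion_pad _ le_pL _ (fun i => eta i w)).
have sumDE (F : multi_index s -> R) : \sum_(g <- D | g != e0 s) F g =
    \sum_(g \in total_degree s q `&` ~` [set e0 s]) F g.
  rewrite big_mkcond fsbig_seq// -DE fsbig_mkcondr; apply: eq_fsbigr => g _.
  case: eqVneq => [->|/eqP g0]; first by rewrite memNset//= => /(_ erefl).
  by rewrite mem_set.
(* A variance is a covariance with itself. Padding sends only [e0 r] to [e0 s], so the excluded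
   indices correspond. *)
have varE r p (c : multi_index r -> R) (le_rs : (r <= s)%N) (le_pq : (p <= q)%N) :
    \sum_(g <- D | g != e0 s) padded_coef p le_rs c g * padded_coef p le_rs c g =
    \sum_(g \in total_degree r p `\ e0 r) c g ^+ 2.
  rewrite sumDE -(fsbig_padded_coef le_rs le_pq c _ (F := fun _ y => y * y)).
    rewrite setDE (_ : @pad r s @^-1` _ = ~` [set e0 r]); last first.
      apply/seteqP; split=> g /= g0 gE; apply: g0; first by rewrite gE pad_e0.
      by apply: (can_inj (padK le_rs)); rewrite gE pad_e0.
    by apply: eq_fsbigr => g _; rewrite expr2.
  by move=> g; rewrite mulr0.
have covE : \sum_(g <- D | g != e0 s) aH g * aL g =
    \sum_(g \in (JH `&` JL) `\ e0 s)
       cH (unpad (leq_maxl rH rL) g) * cL (unpad (leq_maxr rH rL) g).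
  rewrite sumDE; apply/esym.
  transitivity (\sum_(g \in (JH `&` JL) `\ e0 s) aH g * aL g).
    apply: eq_fsbigr => g; rewrite inE => -[[gH gL] _].
    by rewrite /aH /aL /padded_coef !mem_set.
  (* Outside [JH] or outside [JL] one of the two padded coefficients vanishes, so only the
     intersection contributes. *)
  apply: fsbig_widen => [g [[[h hp <-] _] g0]|g [[_ g0] nJ]].
    by split => //; exact: (total_degree_pad (leq_maxl rH rL) le_pH hp).
  rewrite /= /aH /aL /padded_coef.
  case: ifPn => [|_]; last by rewrite mul0r.
  rewrite inE => gH; case: ifPn => [|_]; last by rewrite mulr0.
  by rewrite inE => gL; case: nJ.
rewrite /correlation /variance QHE QLE !covariance_sum_psi//=.
rewrite !varE// covE sqrtrM//.
by apply: fsumr_ge0 => g _; exact: sqr_ge0.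
Qed.
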